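(* Let $\mathbf{K}$ be an arbitrary NS-domain in $\mathbb{R}^2$ with NS-diameter $\mathrm{diam}_{NS}(\mathbf{K})$, and let $r\ge 1$ be an integer. If finitely many planks form an $r$-fold packing in $\mathbf{K}$, then the sum of the widths of the planks is at most $r\,\mathrm{diam}_{NS}(\mathbf{K})$. Here, $2R_{\mathbf{K}}\le \mathrm{diam}_{NS}(\mathbf{K})$, with equality if and only if $2R_{\mathbf{K}}=\mathrm{diam}_{NS}(\mathbf{K})=\mathrm{diam}(\mathbf{K})$.
   Context: A finite family of closed circular disks in $\mathbb{R}^2$ is an NS-family (non-separable arrangement) if no line of $\mathbb{R}^2$ divides the disks into two non-empty sets without touching or intersecting at least one disk; that is, there is no line that is disjoint from all the disks and divides the plane into two open half-planes each containing at least one disk. The convex hull (of the union) of an NS-family of disks is called an NS-domain, and the sum of the diameters of the disks of the (generating) NS-family is called its NS-diameter, denoted $\mathrm{diam}_{NS}(\mathbf{K})$. $R_{\mathbf{K}}$ denotes the circumradius of $\mathbf{K}$, i.e. the radius of the smallest circular disk containing $\mathbf{K}$, and $\mathrm{diam}(\mathbf{K})$ denotes the Euclidean diameter of $\mathbf{K}$. A plank in $\mathbb{R}^2$ is a closed strip between two parallel lines, i.e. a set $C=B+H$ with $H$ a line through the origin and $B$ a closed bounded interval in the line $E=H^\perp$; its width is the length of $B$. Planks $C_i=B_i+H_i$, $i\le N$, form an $r$-fold packing in $\mathbf{K}$ if $B_i\subset P_{E_i}\mathbf{K}$ for every $i\le N$, where $E_i=H_i^\perp$ and $P_{E_i}$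 is the orthogonal projection onto $E_i$, and each point of $\mathbf{K}$ belongs to at most $r$ of the interiors $\mathrm{int}(C_i\cap\mathbf{K})$. *)

(* Defs.v *)
From HB Require Import structures.
From mathcomp Require Import all_boot all_order all_algebra.
From mathcomp Require Import all_classical all_reals all_analysis.
Set Implicit Arguments.
Unset Strict Implicit.
Unset Printing Implicit Defensive.
Import Order.TTheory GRing.Theory Num.Theory.
Import numFieldNormedType.Exports.
Local Open Scope classical_set_scope.
Local Open Scope ring_scope.

(* The plane is 'rV[R]_2.  The library norm `|x| on row vectors is the sup norm,
   so the Euclidean norm is defined here; both norms induce the same topology,
   hence the library's [interior] is the usual one. *)

Definition dot (R : realType) (x y : 'rV[R]_2) : R := (x *m y^T) 0 0.

Definition enorm (R : realType) (x : 'rV[R]_2) : R := Num.sqrt (dot x x).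

Definition closed_disk (R : realType) (c : 'rV[R]_2) (rho : R) : set 'rV[R]_2 :=
  [set x | enorm (x - c) <= rho].

Definition convex_hull (R : realType) (A : set 'rV[R]_2) : set 'rV[R]_2 :=
  smallest (@convex_set R 'rV[R]_2) A.

Definition diameter (R : realType) (K : set 'rV[R]_2) : R :=
  sup [set enorm (x - y) | x in K & y in K].

(* For K nonempty and bounded the infimum is attained: it is the radius of the
   smallest disk containing K. *)
Definition circumradius (R : realType) (K : set 'rV[R]_2) : R :=
  inf [set rho : R | exists c, K `<=` closed_disk c rho].

Record disk (R : realType) := Disk {
  disk_center : 'rV[R]_2;
  disk_radius : R;
  disk_radius_gt0 : 0 < disk_radius
}.

Definition disk_set (R : realType) (D : disk R) : set 'rV[R]_2 :=
  closed_disk (disk_center D) (disk_radius D).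

(* The line {x | <x, u> = t} misses all the disks, and each of the two open
   half-planes that it bounds contains a disk. *)
Definition separating_line (R : realType) (n : nat) (D : 'I_n -> disk R)
    (u : 'rV[R]_2) (t : R) : Prop :=
  [/\ forall i, disk_set (D i) `&` [set x | dot x u = t] = set0,
      exists i, disk_set (D i) `<=` [set x | dot x u < t]
    & exists i, disk_set (D i) `<=` [set x | t < dot x u]].

Definition NS_family (R : realType) (n : nat) (D : 'I_n -> disk R) : Prop :=
  (0 < n)%N /\ ~ exists u t, u != 0 /\ separating_line D u t.

Definition NS_domain (R : realType) (n : nat) (D : 'I_n -> disk R) :
    set 'rV[R]_2 :=
  convex_hull (\bigcup_i disk_set (D i)).

Definition NS_diameter (R : realType) (n : nat) (D : 'I_n -> disk R) : R :=
  \sum_(i < n) 2 * disk_radius (D i).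

(* The line H through the origin is given by a unit normal u, so that E = H^\perp
   is spanned by u and B is the segment {s u | a <= s <= b} of length b - a. *)
Record plank (R : realType) := Plank {
  plank_normal : 'rV[R]_2;
  plank_lo : R;
  plank_hi : R;
  plank_normal_unit : enorm plank_normal = 1;
  plank_lo_le_hi : plank_lo <= plank_hi
}.

Definition plank_line (R : realType) (P : plank R) : set 'rV[R]_2 :=
  [set x | dot x (plank_normal P) = 0].

Definition plank_base (R : realType) (P : plank R) : set 'rV[R]_2 :=
  [set s *: plank_normal P | s in `[plank_lo P, plank_hi P]].

Definition plank_set (R : realType) (P : plank R) : set 'rV[R]_2 :=
  [set x + y | x in plank_base P & y in plank_line P].

Definition plank_width (R : realType) (P : plank R) : R :=
  plank_hi P - plank_lo P.

Definition plank_proj (R : realType) (P : plank R) (x : 'rV[R]_2) : 'rV[R]_2 :=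
  dot x (plank_normal P) *: plank_normal P.

Definition fold_packing (R : realType) (r : nat) (K : set 'rV[R]_2) (N : nat)
    (C : 'I_N -> plank R) : Prop :=
  (forall i, plank_base (C i) `<=` plank_proj (C i) @` K) /\
  (forall x, K x ->
     (#|[set i : 'I_N | `[< interior (plank_set (C i) `&` K) x >] ]%SET| <= r)%N).

(* Main.v *)
Require Import Defs.
From HB Require Import structures.
From mathcomp Require Import all_boot all_order all_algebra.
From mathcomp Require Import all_classical all_reals all_analysis.
From mathcomp Require Import measurable_realfun measurable_fun_approximation.
From mathcomp Require Import ring lra.
Import Order.TTheory GRing.Theory Num.Theory.
Import numFieldNormedType.Exports.
Local Open Scope ring_scope.

(** Packing bound.  Archimedes' theorem says that the area of a sphere lying
    between two parallel planes depends only on their distance.  Projected to the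
    equatorial disk, the area measure of a sphere of radius rho becomes, once
    scaled to total mass 2 rho, a measure whose image under the orthogonal
    projection onto any line is the length measure of the shadow of the disk.
    Summing these measures over the disks of the NS-family gives a measure mu of
    total mass diam_NS.  Since no line separates the disks, the base of a plank of
    the packing is covered by the shadows of the disks, so mu gives the plank at
    least its width; since almost every point of the domain lies in at most r
    planks, the masses of the planks sum to at most r times the total mass.

    The measure appears only through its iterated integral: points of the unit
    disk are written sqrt(1-z^2) (cos theta, sin theta) with z in (0,1), the
    height on the sphere, and theta an angle.  For fixed theta a plank cuts out an
    interval of heights z, of length given by [slice_tail], and multiplicities are
    counted by [sum_length_le_multiplicity].  The integral over theta is replaced
    by primitives: if the primitives F_j of the slice lengths satisfy
    sum F_j' <= r, their increments over a period sum to at most 2 pi r, and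
    rotating a plank only shifts the argument of its F_j, which leaves the
    increment over a period unchanged.  Archimedes' theorem is the value of that
    increment ([half_chord_arc], [slice_tail_primitive]), and [unit_disk_packing]
    is the resulting inequality for one disk.

    Circumradius.  Following Goodman and Goodman, the disk whose center is the
    barycenter of the centers, weighted by the radii, and whose radius is the sum
    P of the radii contains the whole domain.  This is checked on the shadows in
    each direction, which form a chain of intervals: if M is the largest right end,
    the shadows with right end beyond e_j cover (e_j, M], so that M - e_j is at
    most the sum of their lengths, and the weighted average of these inequalities
    is the claim ([chain_right_end]).

    Equality.  If the circumradius is P, some disk touches the boundary of that
    covering disk; in the direction of contact the inequality is an equality, which
    forces the shadows to be juxtaposed end to end ([chain_right_end_eq]).  The
    domain then has width 2 P in that direction, hence diameter 2 P. *)

(** * Lengths of families of intervals *)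

Definition overlap {R : realType} (a b lo hi : R) : R :=
  Num.max 0 (Num.min b hi - Num.max a lo).

(** Integrate the sum of the indicators of the intervals, which is at most r,
    over (0,1). *)
Lemma sum_length_le_multiplicity {R : realType} (N r : nat) (lo hi : 'I_N -> R) :
  (forall j, 0 <= lo j) -> (forall j, hi j <= 1) ->
  (forall s, 0 < s < 1 -> (#|[set j | (lo j < s < hi j)%R]%SET| <= r)%N) ->
  \sum_j Num.max 0 (hi j - lo j) <= r%:R.
Proof.
move=> lo0 hi1 cnt.
pose A j : set R := `]lo j, hi j[%classic.
have mA j : measurable (A j) by exact: measurable_itv.
have muA j : lebesgue_measure (A j) = (Num.max 0 (hi j - lo j))%:E.
  rewrite /A lebesgue_measure_itv/= lte_fin; case: ltP => h.
    by rewrite -EFinB max_r// subr_ge0 ltW.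
  by rewrite max_l// subr_le0.
rewrite -lee_fin -sumEFin.
have -> : (\sum_(j < N) (Num.max 0 (hi j - lo j))%:E
   = \int[lebesgue_measure]_(x in `]0%R, 1%R[%classic) \sum_(j < N) (\1_(A j) x)%:E)%E.
  rewrite ge0_integral_sum//=.
  - apply: eq_bigr => j _; rewrite integral_indic; [|exact: measurable_itv|exact: mA].
    rewrite (_ : (A j `&` _)%classic = A j); first by rewrite -muA.
    apply/setIidl => x; rewrite /A/= !in_itv/= => /andP[l h].
    by rewrite (le_lt_trans (lo0 j) l) (lt_le_trans h (hi1 j)).
  - by move=> j; apply/measurable_EFinP; apply: measurable_indic; exact: mA.
apply: (@le_trans _ _ (\int[lebesgue_measure]_(x in `]0%R, 1%R[%classic) (r%:R)%:E)%E).
  apply: ge0_le_integral => //=.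
  - by move=> x _; rewrite sume_ge0// => j _; rewrite lee_fin.
  - apply: emeasurable_sum => j; apply/measurable_EFinP.
    by apply: measurable_indic; exact: mA.
  - move=> x; rewrite in_itv/= => x01.
    rewrite sumEFin lee_fin (le_trans _ (_ : (#|[set j | (lo j < x < hi j)%R]%SET|)%:R <= _))//.
      rewrite -sum1_card natr_sum [leRHS]big_mkcond/=; apply: ler_sum => j _.
      by rewrite inE indicE /A mem_setE in_itv/=; case: ifP.
    by rewrite ler_nat cnt.
rewrite integral_cst//= lebesgue_measure_itv/= lte_fin ltr01.
by rewrite oppr0 adde0 mule1.
Qed.

Lemma length_le_sum_overlap {R : realType} (n : nat) (P : pred 'I_n)
    (a b : R) (lo hi : 'I_n -> R) :
  (forall s, a < s < b -> exists2 i, P i & lo i <= s <= hi i) ->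
  b - a <= \sum_(i | P i) overlap a b (lo i) (hi i).
Proof.
move=> cov.
have o0 i : 0 <= overlap a b (lo i) (hi i) by rewrite le_max lexx.
have [ba|ab] := leP b a.
  by rewrite (@le_trans _ _ 0) ?subr_le0 ?sumr_ge0.
pose A i : set R := `[Num.max a (lo i), Num.min b (hi i)]%classic.
have mA i : measurable (A i) by exact: measurable_itv.
have muA i : lebesgue_measure (A i) = (overlap a b (lo i) (hi i))%:E.
  rewrite /A lebesgue_measure_itv/= lte_fin /overlap; case: ltP => h.
    by rewrite -EFinB [Num.max 0 _]max_r// subr_ge0 ltW.
  by rewrite [Num.max 0 _]max_l// subr_le0.
rewrite -lee_fin -sumEFin.
have -> : ((b - a)%:E = lebesgue_measure `]a, b[%classic)%E.
  by rewrite lebesgue_measure_itv/= lte_fin ab EFinB.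
under eq_bigr do rewrite -muA.
rewrite (@bigfs _ _ _ _ _ P _ (index_enum_uniq _)); last first.
  by move=> i _; rewrite mem_index_enum.
apply: content_sub_fsum;
  [exact: finite_finset|by move=> i _; exact: mA|exact: measurable_itv|].
move=> s /=; rewrite in_itv/= => sab; have [i Pi /andP[ls sh]] := cov _ sab.
case/andP: sab => sa sb; exists i => //.
by rewrite /A/= in_itv/= ge_max le_min ls sh !ltW.
Qed.

(** * Archimedes' theorem on heights and angles *)

(** The interval (-M, M) suffices for every use below, and lets the primitive be
    an integral with a fixed left end. *)
Lemma exists_primitive {R : realType} (g : R -> R) (M : R) : continuous g ->
  exists F : R -> R, forall x, - M < x < M -> is_derive x (1 : R) F (g x).
Proof.
move=> cg; exists (fun x => \int[lebesgue_measure]_(t in `[- M, x]) g t) => x /andP[xM Mx].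
have [] := @continuous_FTC1_closed R g (- M) x M Mx _ xM (cg x).
  apply: continuous_compact_integrable; first exact: segment_compact.
  exact: continuous_subspaceT.
by move=> dF F'; rewrite -F' derive1E; exact/derivableP.
Qed.

Lemma derive_eq_increment {R : realType} (f g df : R -> R) (a b : R) : a <= b ->
  (forall x, a <= x <= b -> is_derive x (1 : R) f (df x)) ->
  (forall x, a <= x <= b -> is_derive x (1 : R) g (df x)) ->
  f b - f a = g b - g a.
Proof.
move=> ab Hf Hg.
have Hfg x : a <= x <= b -> is_derive x (1 : R) (f - g) 0.
  move=> xab; rewrite -(subrr (df x)).
  by have := Hf x xab; have := Hg x xab => ? ?; exact: is_deriveB.
have [| |c _] := @MVT_segment R (f - g) (fun=> 0) a b ab.
- by move=> x; rewrite in_itv/= => /andP[ax xb]; apply: Hfg; rewrite !ltW.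
- apply: derivable_within_continuous => x; rewrite in_itv/= => xab.
  by have [] := Hfg _ xab.
- by rewrite mul0r !fctE => /eqP; rewrite subr_eq0 => /eqP h; lra.
Qed.

Lemma derive_ge0_le {R : realType} (f df : R -> R) (a b : R) : a <= b ->
  (forall x, a <= x <= b -> is_derive x (1 : R) f (df x)) ->
  (forall x, a <= x <= b -> 0 <= df x) -> f a <= f b.
Proof.
move=> ab Hf df0.
have [| |c] := @MVT_segment R f df a b ab.
- by move=> x; rewrite in_itv/= => /andP[ax xb]; apply: Hf; rewrite !ltW.
- apply: derivable_within_continuous => x; rewrite in_itv/= => xab.
  by have [] := Hf _ xab.
- by rewrite in_itv/= => /df0 d0 h; rewrite -subr_ge0 h mulr_ge0// subr_ge0.
Qed.

(** Measure of the heights z in [0,1] with s < sqrt(1-z^2) k, for s > 0.  Writing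
    max s k makes the two cases k <= s and k > s into one continuous formula. *)
Definition half_chord {R : realType} (s k : R) : R :=
  Num.sqrt (1 - (s / Num.max s k) ^+ 2).

Lemma half_chord_continuous {R : realType} (s : R) : 0 < s ->
  continuous (fun t => half_chord s (cos t)).
Proof.
move=> s0 t; rewrite /half_chord.
apply: (@continuous_comp _ _ _ (fun t => 1 - (s / Num.max s (cos t)) ^+ 2) Num.sqrt);
  last exact: sqrt_continuous.
apply: continuousB; first exact: cst_continuous.
apply: (@continuous_comp _ _ _ (fun t => s / Num.max s (cos t)) (fun x => x ^+ 2));
  last exact: exprn_continuous.
apply: continuousM; first exact: cst_continuous.
apply: continuousV; first by rewrite gt_eqF// lt_max s0.
apply: continuous_max; first exact: cst_continuous.
exact: continuous_cos.
Qed.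

(** For 0 < s this is p - s * atan (s * tan p), in a form that is smooth at the
    odd multiples of pi/2: p minus the arctangent below is atan (s * tan p) by the
    addition formula.  It is the antiderivative behind Archimedes' theorem. *)
Definition tilted_angle {R : realType} (s p : R) : R :=
  p - s * (p - atan ((1 - s) * (sin p * cos p) / (cos p ^+ 2 + s * sin p ^+ 2))).

Lemma tilted_angle_derive {R : realType} (s p : R) : 0 < s ->
  is_derive p (1 : R) (tilted_angle s)
    (1 - s * (s / (cos p ^+ 2 + s ^+ 2 * sin p ^+ 2))).
Proof.
move=> s0.
pose D p : R := cos p ^+ 2 + s * sin p ^+ 2.
have cs := @cos2Dsin2 R p.
have c20 : 0 <= cos p ^+ 2 by rewrite sqr_ge0.
have s20 : 0 <= sin p ^+ 2 by rewrite sqr_ge0.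
have D0 : 0 < D p.
  rewrite /D; have [sn|sn] := eqVneq (sin p) 0.
    by move: cs; rewrite sn expr0n/= mulr0 !addr0 => ->; exact: ltr01.
  have sp : 0 < sin p ^+ 2 by rewrite lt0r sqr_ge0 sqrf_eq0 sn.
  by apply: (ltr_wpDl c20); exact: mulr_gt0.
have E0 : 0 < cos p ^+ 2 + s ^+ 2 * sin p ^+ 2.
  have [sn|sn] := eqVneq (sin p) 0.
    by move: cs; rewrite sn expr0n/= mulr0 !addr0 => ->; exact: ltr01.
  have sp : 0 < sin p ^+ 2 by rewrite lt0r sqr_ge0 sqrf_eq0 sn.
  by apply: (ltr_wpDl c20); apply: mulr_gt0 => //; exact: exprn_gt0.
have dD : is_derive p (1 : R) D (- 2 * (1 - s) * (cos p * sin p)).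
  have h := is_deriveD (is_deriveX 2 (is_derive_cos p))
    (is_deriveZ s (is_deriveX 2 (is_derive_sin p))).
  apply: (is_derive_eq h); rewrite /GRing.scale/= !expr1; ring.
have dDV := is_deriveV (lt0r_neq0 D0) dD.
have dN : is_derive p (1 : R) ((1 - s) *: (sin * cos) : R -> R)
    ((1 - s) * (cos p ^+ 2 - sin p ^+ 2)).
  have h := is_deriveZ (1 - s) (is_deriveM (is_derive_sin p) (is_derive_cos p)).
  by apply: (is_derive_eq h); rewrite /GRing.scale/=; ring.
have dQ := is_deriveM dN dDV.
have dA := is_derive1_comp (is_derive1_atan _) dQ.
have dG := is_deriveB (is_derive_id p (1 : R))
  (is_deriveZ s (is_deriveB (is_derive_id p (1 : R)) dA)).
refine (@is_derive_eq _ _ _ (tilted_angle s) _ _ _ _ dG _).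
rewrite !fctE /GRing.scale/=.
clear -cs D0 E0; rewrite {}/D in D0 *.
move: D0 E0 cs; move: (cos p) (sin p) => x y D0 E0 cs.
set E := x ^+ 2 + s ^+ 2 * y ^+ 2 in E0 *.
set D := x ^+ 2 + s * y ^+ 2 in D0 *.
have Dn0 : D != 0 by rewrite gt_eqF.
have En0 : E != 0 by rewrite gt_eqF.
have ED : D ^+ 2 + ((1 - s) * (y * x)) ^+ 2 = E.
  transitivity ((x ^+ 2 + y ^+ 2) * E); first by rewrite /D /E; ring.
  by rewrite cs mul1r.
have -> : 1 + ((1 - s) * (y * x) / D) ^+ 2 = E / D ^+ 2.
  by rewrite -ED; field.
have -> : (1 - s) * (y * x) * (- D ^- 2 * (-2 * (1 - s) * (x * y))) +
    D^-1 * ((1 - s) * (x ^+ 2 - y ^+ 2)) =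
    (x ^+ 2 + y ^+ 2) * ((1 - s) * (x ^+ 2 - s * y ^+ 2)) / D ^+ 2.
  apply: (mulfI (expf_neq0 2 Dn0)); rewrite [RHS]mulrCA mulfV ?expf_neq0// mulr1.
  rewrite mulrDr (_ : D ^+ 2 * (_ * (- D ^- 2 * _)) = 2 * ((1 - s) * (x * y)) ^+ 2).
    by rewrite (_ : D ^+ 2 * (D^-1 * _) = D * ((1 - s) * (x ^+ 2 - y ^+ 2)));
      [rewrite /D; ring|field].
  by field.
rewrite cs mul1r.
have -> : (E / D ^+ 2)^-1 * ((1 - s) * (x ^+ 2 - s * y ^+ 2) / D ^+ 2) = 1 - s / E.
  have -> : (1 - s) * (x ^+ 2 - s * y ^+ 2) = E - s * (x ^+ 2 + y ^+ 2).
    by rewrite /E; ring.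
  by rewrite cs; field; rewrite Dn0 En0.
by rewrite opprB addrCA subrr addr0.
Qed.

(** The function half_chord s (cos x) vanishes outside [-asin k, asin k], where
    k = sqrt(1-s^2).  Inside, the substitution sin x = k sin p turns it into the
    derivative of [tilted_angle], which also absorbs the singular behaviour of the
    integrand at the ends of the arc. *)
Lemma half_chord_arc {R : realType} (s : R) (F : R -> R) : 0 < s <= 1 ->
  (forall x, - pi <= x <= pi -> is_derive x (1 : R) F (half_chord s (cos x))) ->
  F pi - F (- pi) = pi * (1 - s).
Proof.
move=> /andP[s0 s1] dF.
have pi0 : 0 < (pi : R) := pi_gt0 R.
set k := Num.sqrt (1 - s ^+ 2).
have s21 : s ^+ 2 <= 1 by rewrite exprn_ile1// ltW.
have k2 : k ^+ 2 = 1 - s ^+ 2 by rewrite sqr_sqrtr// subr_ge0.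
have k0 : 0 <= k by rewrite sqrtr_ge0.
have k1 : k < 1 by rewrite -(ltr_pXn2r (n:=2)) ?nnegrE// k2 expr1n ltrBlDr ltrDl exprn_gt0.
have kB : -1 <= k <= 1 by rewrite (le_trans _ k0) ?lerN10// ltW.
pose al : R := asin k.
have al0 : 0 <= al.
  rewrite leNgt; apply/negP => al0.
  have : 0 < sin (- al) by apply: sin_gt0_pi; have := asin_geNpi2 kB; rewrite -/al; lra.
  by rewrite sinN asinK ?in_itv//=; lra.
have alh : al <= pi / 2 := asin_lepi2 kB.
have cal : cos al = s by rewrite cos_asin// k2 subKr sqrtr_sqr ger0_norm// ltW.
have flat x : al <= x <= pi -> half_chord s (cos x) = 0.
  move=> /andP[ax xp]; rewrite /half_chord max_l.
    by rewrite divff ?gt_eqF// expr1n subrr sqrtr0.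
  by rewrite -cal leNgt ltr_cos ?in_itv/= ?al0 ?(le_trans al0 ax)//= -?leNgt ?(le_trans ax).
have F1 : F pi - F al = 0.
  have -> : 0 = cst (0 : R) (pi : R) - cst 0 al by rewrite /= subrr.
  apply: (@derive_eq_increment R F (cst 0) (fun=> 0)).
  - by lra.
  - by move=> x xab; rewrite -(flat x)//; apply: dF; lra.
have F2 : F (- al) - F (- pi) = 0.
  have -> : 0 = cst (0 : R) (- al) - cst 0 (- pi : R) by rewrite /= subrr.
  apply: (@derive_eq_increment R F (cst 0) (fun=> 0)).
  - by lra.
  - by move=> x xab; rewrite -(flat (- x)) ?cosN; [apply: dF; lra|lra].
have F1' : F pi = F al by apply/eqP; rewrite -subr_eq0 F1.
have F2' : F (- al) = F (- pi) by apply/eqP; rewrite -subr_eq0 F2.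
(* The angle x as a function of p; it covers the arc when |p| <= pi/2. *)
pose th p : R := asin (k * sin p).
have thh : th (pi / 2) = al by rewrite /th sin_pihalf mulr1.
have thNh : th (- (pi / 2)) = - al.
  rewrite /th sinN sin_pihalf mulrN1 -[k in - k](@asinK R) ?in_itv//= -sinN.
  by rewrite -/al sinK// in_itv/=; lra.
suff inc : (F \o th) (pi / 2) - (F \o th) (- (pi / 2)) =
    tilted_angle s (pi / 2) - tilted_angle s (- (pi / 2)).
  move: inc; rewrite /= thh thNh -F1' F2' => ->.
  rewrite /tilted_angle sinN cosN cos_pihalf !mulr0 !mul0r atan0.
  by field.
apply: (@derive_eq_increment R (F \o th) (tilted_angle s)
  (fun p => 1 - s * (s / (cos p ^+ 2 + s ^+ 2 * sin p ^+ 2)))).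
- by lra.
- move=> p pI.
  have cp0 : 0 <= cos p by apply: cos_ge0_pihalf.
  have cs := @cos2Dsin2 R p.
  set c := cos p in cp0 cs *; set y := sin p in cs *.
  have E : 1 - (k * y) ^+ 2 = c ^+ 2 + s ^+ 2 * y ^+ 2 
    by rewrite exprMn k2 (_ : c ^+ 2 = 1 - y ^+ 2); [ring|rewrite -cs addrK].
  have yB : -1 <= y <= 1 by rewrite sin_geN1 sin_le1.
  have kyB : -1 < k * y < 1.
    by case/andP: yB => ? ?; apply/andP; split; nra.
  have kyB' : -1 <= k * y <= 1 by case/andP: kyB => ? ?; rewrite !ltW.
  have cth : cos (th p) = Num.sqrt (c ^+ 2 + s ^+ 2 * y ^+ 2).
    by rewrite cos_asin// E.
  set q := Num.sqrt (c ^+ 2 + s ^+ 2 * y ^+ 2) in cth.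
  have E0 : 0 <= c ^+ 2 + s ^+ 2 * y ^+ 2 
    by apply: addr_ge0; [exact: sqr_ge0|apply: mulr_ge0; exact: sqr_ge0].
  have q2 : q ^+ 2 = c ^+ 2 + s ^+ 2 * y ^+ 2 by rewrite sqr_sqrtr.
  have sq : s <= q.
    rewrite -(ler_pXn2r (n:=2)) ?nnegrE ?sqrtr_ge0 ?(ltW s0)// q2.
    by rewrite -[leLHS]mulr1 -cs mulrDr lerD2r ler_piMl ?sqr_ge0.
  have q0 : 0 < q by exact: lt_le_trans sq.
  have hc : half_chord s (cos (th p)) = k * c / q.
    rewrite /half_chord cth max_r// -[RHS]ger0_norm; last by rewrite !mulr_ge0// invr_ge0 ltW.
    rewrite -sqrtr_sqr; congr Num.sqrt.
    rewrite !exprMn exprVn q2 k2.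
    have En : c ^+ 2 + s ^+ 2 * y ^+ 2 != 0 by rewrite -q2 expf_neq0// gt_eqF.
    apply: (mulIf En); rewrite mulrBl !divfK// mul1r.
    have -> : y ^+ 2 = 1 - c ^+ 2 by rewrite -cs addrC addKr.
    ring.
  have thI : - pi <= th p <= pi.
    by have := asin_geNpi2 kyB'; have := asin_lepi2 kyB'; rewrite /th; lra.
  have d1 : is_derive (k * sin p) (1 : R) asin q^-1.
    by have := is_derive1_asin kyB; rewrite E.
  have d0 := is_deriveZ k (is_derive_sin p).
  have d2 := @is_derive1_comp R asin (k *: sin) p _ _ d1 d0.
  have := is_derive1_comp (dF _ thI) d2.
  rewrite hc (_ : k * c / q * _ = 1 - s * (s / (c ^+ 2 + s ^+ 2 * y ^+ 2)))//.
  rewrite -/c /GRing.scale/= -q2.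
  have -> : k * c / q * (q^-1 * (k * c)) = k ^+ 2 * c ^+ 2 / q ^+ 2.
    by field; rewrite gt_eqF.
  have qn : q ^+ 2 != 0 by rewrite expf_neq0// gt_eqF.
  apply: (mulIf qn); rewrite divfK// mulrBl mul1r mulrA divfK// q2 k2.
  have -> : y ^+ 2 = 1 - c ^+ 2 by rewrite -cs addrC addKr.
  ring.
- by move=> p _; exact: tilted_angle_derive.
Qed.

(** As the integrand is periodic, the increment over a period does not depend on
    where the period starts, and the one from -pi to pi is known. *)
Lemma half_chord_primitive {R : realType} (s M : R) : 0 < s <= 1 -> pi < M ->
  exists F : R -> R,
    (forall x, - M < x < M -> is_derive x (1 : R) F (half_chord s (cos x))) /\
    (forall y, - M < y -> y + pi *+ 2 < M -> F (y + pi *+ 2) - F y = pi * (1 - s)).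
Proof.
move=> s01 piM; have pi0 := pi_gt0 R.
have /andP[s0 _] := s01.
have [F dF] := @exists_primitive R _ M (half_chord_continuous s s0).
exists F; split=> // y My yM.
have per a b : a <= b -> - M < a -> b + pi *+ 2 < M ->
    F (b + pi *+ 2) - F (a + pi *+ 2) = F b - F a.
  move=> ab Ma bM.
  apply: (@derive_eq_increment R (fun x => F (x + pi *+ 2)) F
    (fun x => half_chord s (cos x))) => // x /andP[ax xb].
    have d : is_derive (x + pi *+ 2) (1 : R) F (half_chord s (cos (x + pi *+ 2))).
      by apply: dF; rewrite -mulr_natr in bM *; lra.
    have dx := is_deriveD (is_derive_id x (1 : R)) (is_derive_cst (pi *+ 2 : R) x (1:R)).
    rewrite cosD2pi in d.
    have := @is_derive1_comp R F (id + cst (pi *+ 2 : R)) x _ _ d dx.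
    by rewrite addr0 mulr1.
  by apply: dF; rewrite -mulr_natr in bM *; lra.
have arc : F pi - F (- pi) = pi * (1 - s).
  by apply: half_chord_arc => // x xI; apply: dF; lra.
have e : - pi + pi *+ 2 = pi :> R by rewrite -mulr_natr; lra.
rewrite -arc; have [h|h] := leP y (- pi).
  by have := per _ _ h My; rewrite e => /(_ piM) h'; lra.
by have := per _ _ (ltW h); rewrite e yM => h'; have := h' _ isT; lra.
Qed.

(** Measure of the heights z in [0,1] with s < sqrt(1-z^2) k, for s of any sign;
    the case s < 0 follows from s > 0 by the symmetry x -> -x. *)
Definition slice_tail {R : realType} (s k : R) : R :=
  if 0 < s then half_chord s k else 1 - half_chord (- s) (- k).

(** Archimedes' theorem: averaged over all angles, the measure of the heights whose
    point projects beyond s is proportional to 1 - s.  The value s = 0 is left out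
    since slice_tail 0 is discontinuous. *)
Lemma slice_tail_primitive {R : realType} (s M : R) : s != 0 -> -1 <= s <= 1 -> pi < M ->
  exists F : R -> R,
    (forall x, - M < x < M -> is_derive x (1 : R) F (slice_tail s (cos x))) /\
    (forall y, - M < y -> y + pi *+ 2 < M -> F (y + pi *+ 2) - F y = pi * (1 - s)).
Proof.
move=> sn0 /andP[sN1 s1] piM; have pi0 := pi_gt0 R; rewrite /slice_tail; case: ltP => s0.
  by apply: half_chord_primitive; rewrite // s0.
have Ns : 0 < - s <= 1 by rewrite oppr_gt0 lt_neqAle sn0 s0 lerNl.
have [|F [dF pF]] := @half_chord_primitive R (- s) (M + pi) Ns; first by lra.
exists (id - (fun x => F (x + pi))); split.
  move=> x xM.
  have d : is_derive (x + pi) (1 : R) F (half_chord (- s) (cos (x + pi))).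
    by apply: dF; lra.
  rewrite cosDpi in d.
  have dx := is_deriveD (is_derive_id x (1 : R)) (is_derive_cst (pi : R) x (1:R)).
  have dc := @is_derive1_comp R F (id + cst (pi : R)) x _ _ d dx.
  rewrite addr0 mulr1 in dc.
  exact: (is_deriveB (is_derive_id x (1 : R)) dc).
move=> y My yM; rewrite !fctE /=.
have := pF (y + pi); rewrite addrAC => h.
have : F (y + pi *+ 2 + pi) - F (y + pi) = pi * (1 - - s) by apply: h; lra.
by rewrite -mulr_natr => h'; lra.
Qed.

Lemma half_chord_ge0 {R : realType} (s k : R) : 0 <= half_chord s k.
Proof. exact: sqrtr_ge0. Qed.

Lemma half_chord_le1 {R : realType} (s k : R) : half_chord s k <= 1.
Proof. by rewrite -[leRHS]sqrtr1 ler_wsqrtr// gerBl sqr_ge0. Qed.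

Lemma slice_tail_ge0 {R : realType} (s k : R) : 0 <= slice_tail s k.
Proof. by rewrite /slice_tail; case: ifP; rewrite ?half_chord_ge0// subr_ge0 half_chord_le1. Qed.

Lemma slice_tail_le1 {R : realType} (s k : R) : slice_tail s k <= 1.
Proof. by rewrite /slice_tail; case: ifP; rewrite ?half_chord_le1// gerBl half_chord_ge0. Qed.

(** half_chord s k is the height below which the slice lies beyond s. *)
Lemma lt_half_chord {R : realType} (s k z : R) : 0 < s -> 0 < z < 1 ->
  (z < half_chord s k -> s < Num.sqrt (1 - z ^+ 2) * k) /\
  (half_chord s k < z -> Num.sqrt (1 - z ^+ 2) * k < s).
Proof.
move=> s0 /andP[z0 z1]; set w := Num.sqrt _.
have z21 : 0 < 1 - z ^+ 2 by rewrite subr_gt0 exprn_ilt1// ltW.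
have w0 : 0 < w by rewrite sqrtr_gt0.
have w2 : w ^+ 2 = 1 - z ^+ 2 by rewrite sqr_sqrtr// ltW.
have w1 : w < 1.
  by rewrite -(ltr_pXn2r (n:=2)) ?nnegrE ?(ltW w0)// w2 expr1n ltrBlDr ltrDl exprn_gt0.
rewrite /half_chord; have [ks|sk] := leP k s.
  rewrite divff ?gt_eqF// expr1n subrr sqrtr0; split; first by rewrite ltNge (ltW z0).
  by move=> _; nra.
have k0 : 0 < k by exact: lt_trans sk.
have kn0 : k ^+ 2 != 0 by rewrite expf_neq0// gt_eqF.
have q1 : 0 <= 1 - (s / k) ^+ 2.
  by rewrite subr_ge0 exprn_ile1 ?divr_ge0 ?ltW// ltr_pdivrMr// mul1r.
have e : w ^+ 2 * k ^+ 2 - s ^+ 2 = (1 - (s / k) ^+ 2 - z ^+ 2) * k ^+ 2.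
  by rewrite w2; field; rewrite gt_eqF.
have k20 : 0 < k ^+ 2 by rewrite exprn_gt0.
split=> h.
  rewrite -(ltr_pXn2r (n:=2)) ?nnegrE ?(ltW s0) ?mulr_ge0 ?ltW// exprMn -subr_gt0 e.
  rewrite mulr_gt0// subr_gt0.
  have : z ^+ 2 < Num.sqrt (1 - (s / k) ^+ 2) ^+ 2.
    by rewrite ltr_pXn2r ?nnegrE ?sqrtr_ge0 ?(ltW z0).
  by rewrite sqr_sqrtr.
rewrite -(ltr_pXn2r (n:=2)) ?nnegrE ?(ltW s0) ?mulr_ge0 ?(ltW w0) ?(ltW k0)// exprMn.
rewrite -subr_lt0 e pmulr_llt0// subr_lt0.
have : Num.sqrt (1 - (s / k) ^+ 2) ^+ 2 < z ^+ 2.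
  by rewrite ltr_pXn2r ?nnegrE ?sqrtr_ge0 ?(ltW z0).
by rewrite sqr_sqrtr.
Qed.

Lemma half_chord0 {R : realType} (s k : R) : 0 < s -> k <= 0 -> half_chord s k = 0.
Proof.
move=> s0 k0; rewrite /half_chord max_l ?(le_trans k0) ?ltW//.
by rewrite divff ?gt_eqF// expr1n subrr sqrtr0.
Qed.

Lemma slice_tailN {R : realType} (s k : R) : s != 0 ->
  slice_tail (- s) (- k) = 1 - slice_tail s k.
Proof.
move=> sn; rewrite /slice_tail oppr_gt0 !opprK.
by case: ltgtP sn => // s0 _; rewrite ?subKr.
Qed.

Lemma lt_slice_tail {R : realType} (s k z : R) : s != 0 -> 0 <= k -> 0 < z < 1 ->
  (z < slice_tail s k -> s < Num.sqrt (1 - z ^+ 2) * k) /\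
  (slice_tail s k < z -> Num.sqrt (1 - z ^+ 2) * k < s).
Proof.
move=> sn k0 z01; rewrite /slice_tail; case: (ltP 0 s) => s0 /=.
  by have := lt_half_chord s k z s0 z01.
have {}s0 : s < 0 by rewrite lt_neqAle sn.
rewrite half_chord0 ?oppr_gt0 ?oppr_le0// subr0; split.
  by move=> _; rewrite (lt_le_trans s0)// mulr_ge0// sqrtr_ge0.
by case/andP: z01 => _ z1 /lt_trans/(_ z1); rewrite ltxx.
Qed.

(** At a fixed angle every plank cuts out an interval of heights: it runs from
    slice_tail b to slice_tail a when k >= 0, and the heights get reversed when
    k < 0.  The common multiplicity bounds the sum of the lengths. *)
Lemma sum_slice_tail_le {R : realType} (N r : nat) (a b k : 'I_N -> R) :
  (forall j, a j != 0) -> (forall j, b j != 0) ->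
  (forall w, 0 < w < 1 -> (#|[set j | (a j < w * k j < b j)%R]%SET| <= r)%N) ->
  \sum_j (slice_tail (a j) (k j) - slice_tail (b j) (k j)) <= r%:R.
Proof.
move=> an bn cnt.
pose lo j := if 0 <= k j then slice_tail (b j) (k j) else 1 - slice_tail (a j) (k j).
pose hi j := if 0 <= k j then slice_tail (a j) (k j) else 1 - slice_tail (b j) (k j).
apply: (@le_trans _ _ (\sum_j Num.max 0 (hi j - lo j))).
  apply: ler_sum => j _; rewrite le_max /hi /lo; apply/orP; right.
  by case: ifP => _; lra.
apply: sum_length_le_multiplicity => [j|j|z z01].
- by rewrite /lo; case: ifP; rewrite ?slice_tail_ge0// subr_ge0 slice_tail_le1.
- by rewrite /hi; case: ifP; rewrite ?slice_tail_le1// gerBl slice_tail_ge0.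
apply: (leq_trans _ (cnt (Num.sqrt (1 - z ^+ 2)) _)); last first.
  have /andP[z0 z1] := z01; rewrite sqrtr_gt0 subr_gt0 exprn_ilt1 ?(ltW z0)//=.
  by rewrite -[ltRHS]sqrtr1 ltr_sqrt// ltrBlDr ltrDl exprn_gt0.
apply: subset_leq_card; apply/fintype.subsetP => j; rewrite !inE /lo /hi.
case: (leP 0 (k j)) => [k0|/ltW k0] /andP[l h].
  by rewrite (lt_slice_tail _ _ _ (an j) k0 z01).1// (lt_slice_tail _ _ _ (bn j) k0 z01).2.
have Nk0 : 0 <= - k j by rewrite oppr_ge0.
have Nan : - a j != 0 by rewrite oppr_eq0.
have Nbn : - b j != 0 by rewrite oppr_eq0.
have [_ /(_ _)] := lt_slice_tail _ _ _ Nan Nk0 z01; rewrite slice_tailN// => /(_ l).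
have [/(_ _) + _] := lt_slice_tail _ _ _ Nbn Nk0 z01; rewrite slice_tailN// => /(_ h).
by rewrite mulrN !ltrN2 => -> ->.
Qed.

(** * Packing planks in the unit disk *)

(** r theta minus the sum of the primitives of the slice lengths is nondecreasing
    in theta; compare its values at 0 and 2 pi. *)
Lemma unit_disk_packing_neq0 {R : realType} (N r : nat) (a b phi : 'I_N -> R) :
  (forall j, a j != 0) -> (forall j, b j != 0) ->
  (forall j, -1 <= a j <= 1) -> (forall j, -1 <= b j <= 1) ->
  (forall j, - pi <= phi j <= pi) ->
  (forall w t, 0 < w < 1 ->
    (#|[set j | (a j < w * cos (t - phi j) < b j)%R]%SET| <= r)%N) ->
  \sum_j (b j - a j) <= 2 * r%:R.
Proof.
move=> an bn a1 b1 phipi cnt; have pi0 := pi_gt0 R.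
(* The shifted angles theta - phi j stay in [-pi, 3 pi]. *)
have piM : pi < 4 * pi :> R by lra.
have [Fa HFa] := boolp.choice (fun j => slice_tail_primitive (a j) (4 * pi) (an j) (a1 j) piM).
have [Fb HFb] := boolp.choice (fun j => slice_tail_primitive (b j) (4 * pi) (bn j) (b1 j) piM).
pose T j t : R := slice_tail (a j) (cos (t - phi j)) - slice_tail (b j) (cos (t - phi j)).
pose H j t : R := Fa j (t - phi j) - Fb j (t - phi j).
have dH j t : 0 <= t <= pi *+ 2 -> is_derive t (1 : R) (H j) (T j t).
  rewrite -mulr_natr => tI; have := phipi j => phiI.
  have I : - (4 * pi) < t - phi j < 4 * pi by lra.
  have dx := is_deriveD (is_derive_id t (1 : R)) (is_derive_cst (- phi j : R) t (1:R)).
  have da := @is_derive1_comp R (Fa j) (id + cst (- phi j : R)) t _ _ ((HFa j).1 _ I) dx.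
  have db := @is_derive1_comp R (Fb j) (id + cst (- phi j : R)) t _ _ ((HFb j).1 _ I) dx.
  have := is_deriveB da db.
  by rewrite addr0 !mulr1.
have : 0 <= r%:R * (pi *+ 2) - \sum_j (H j (pi *+ 2) - H j 0).
  pose Q : R -> R := r%:R *: id - (\sum_j H j).
  have QE t : Q t = r%:R * t - \sum_j H j t by rewrite /Q !fctE fct_sumE.
  suff : Q 0 <= Q (pi *+ 2) by rewrite !QE [in X in _ -> X]sumrB; lra.
  apply: (@derive_ge0_le R Q (fun t => r%:R - \sum_j T j t)).
  - by rewrite mulrn_wge0// ltW.
  - move=> t tI.
    have dr := is_deriveZ r%:R (is_derive_id t (1 : R)).
    have ds := @is_derive_sum _ _ _ _ H t 1 _ (fun j => dH j t tI).
    have := is_deriveB dr ds.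
    by rewrite /GRing.scale/= mulr1.
  - move=> t tI; rewrite subr_ge0; apply: sum_slice_tail_le => // w w01; exact: cnt.
have -> : \sum_j (H j (pi *+ 2) - H j 0) = pi * \sum_j (b j - a j).
  rewrite mulr_sumr; apply: eq_bigr => j _; rewrite /H sub0r.
  have phiI := phipi j.
  have : Fa j (- phi j + pi *+ 2) - Fa j (- phi j) = pi * (1 - a j).
    by apply: (HFa j).2; [lra|rewrite -mulr_natr; lra].
  have : Fb j (- phi j + pi *+ 2) - Fb j (- phi j) = pi * (1 - b j).
    by apply: (HFb j).2; [lra|rewrite -mulr_natr; lra].
  by rewrite [pi *+ 2 - _]addrC; lra.
move=> h; rewrite -(ler_pM2l pi0); move: h; rewrite -mulr_natr; lra.
Qed.

(** Planks with a boundary line through the center are shrunk by an arbitrarily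
    small amount on that side. *)
Lemma unit_disk_packing {R : realType} (N r : nat) (a b phi : 'I_N -> R) :
  (forall j, -1 <= a j <= 1) -> (forall j, -1 <= b j <= 1) ->
  (forall j, - pi <= phi j <= pi) ->
  (forall w t, 0 < w < 1 ->
    (#|[set j | (a j < w * cos (t - phi j) < b j)%R]%SET| <= r)%N) ->
  \sum_j (b j - a j) <= 2 * r%:R.
Proof.
move=> a1 b1 phipi cnt; apply/ler_addgt0Pr => e e0.
pose d := Num.min 1 (e / (2 * N.+1%:R)).
have N0 : 0 < (2 * N.+1%:R : R) by rewrite mulr_gt0// ltr0n.
have d0 : 0 < d by rewrite lt_min ltr01/= divr_gt0.
have d1 : d <= 1 by rewrite ge_min lexx.
have de : d * (2 * N.+1%:R) <= e by rewrite -ler_pdivlMr// ge_min lexx orbT.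
(* Moving each vanishing end by d costs at most 2 d per plank. *)
pose a' j := if a j == 0 then d else a j.
pose b' j := if b j == 0 then - d else b j.
have := @unit_disk_packing_neq0 R N r a' b' phi.
have h1 j : a' j != 0 by rewrite /a'; case: ifPn => //; rewrite gt_eqF.
have h2 j : b' j != 0 by rewrite /b'; case: ifPn => //; rewrite oppr_eq0 (gt_eqF d0).
have h3 j : -1 <= a' j <= 1 by rewrite /a'; case: ifPn => // _; lra.
have h4 j : -1 <= b' j <= 1 by rewrite /b'; case: ifPn => // _; lra.
move=> /(_ h1 h2 h3 h4 phipi) h.
have {}h : \sum_j (b' j - a' j) <= 2 * r%:R.
  apply: h => w t w01; apply: leq_trans (cnt w t w01).
  apply: subset_leq_card; apply/fintype.subsetP => j; rewrite !inE /a' /b'.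
  by case: eqP => [->|_]; case: eqP => [->|_] /andP[l g]; apply/andP; split; lra.
apply: (@le_trans _ _ (\sum_j (b' j - a' j + 2 * d))).
  apply: ler_sum => j _; rewrite /a' /b'.
  by case: eqP => [->|_]; case: eqP => [->|_]; lra.
rewrite big_split/= lerD// sumr_const card_ord.
by apply: le_trans de; rewrite -mulr_natr -natr1; lra.
Qed.

(** * Euclidean geometry of the plane *)

Lemma dotE {R : realType} (x y : 'rV[R]_2) : dot x y = x 0 0 * y 0 0 + x 0 1 * y 0 1.
Proof.
rewrite /dot mxE big_ord_recl big_ord1 !mxE.
by congr (_ + x _ _ * y _ _); apply/val_inj.
Qed.

Lemma dotDl {R : realType} (x y z : 'rV[R]_2) : dot (x + y) z = dot x z + dot y z.
Proof. by rewrite !dotE !mxE; ring. Qed.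

Lemma dotNl {R : realType} (x z : 'rV[R]_2) : dot (- x) z = - dot x z.
Proof. by rewrite !dotE !mxE; ring. Qed.

Lemma dotZl {R : realType} (a : R) (x z : 'rV[R]_2) : dot (a *: x) z = a * dot x z.
Proof. by rewrite !dotE !mxE; ring. Qed.

Lemma dotC {R : realType} (x y : 'rV[R]_2) : dot x y = dot y x.
Proof. by rewrite !dotE; ring. Qed.

Lemma dot_ge0 {R : realType} (x : 'rV[R]_2) : 0 <= dot x x.
Proof. by rewrite dotE -!expr2 addr_ge0 ?sqr_ge0. Qed.

Lemma enorm_ge0 {R : realType} (x : 'rV[R]_2) : 0 <= enorm x.
Proof. exact: sqrtr_ge0. Qed.

Lemma sqr_enorm {R : realType} (x : 'rV[R]_2) : enorm x ^+ 2 = dot x x.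
Proof. by rewrite sqr_sqrtr ?dot_ge0. Qed.

Lemma enormZ {R : realType} (a : R) (x : 'rV[R]_2) : enorm (a *: x) = `|a| * enorm x.
Proof. by rewrite /enorm dotZl dotC dotZl mulrA -expr2 sqrtrM ?sqr_ge0// sqrtr_sqr. Qed.

Lemma enormN {R : realType} (x : 'rV[R]_2) : enorm (- x) = enorm x.
Proof. by rewrite -scaleN1r enormZ normrN1 mul1r. Qed.

Lemma dot_le_enorm {R : realType} (x y : 'rV[R]_2) : dot x y <= enorm x * enorm y.
Proof.
apply: le_trans (ler_norm _) _.
rewrite -(ler_pXn2r (n:=2)) ?nnegrE ?mulr_ge0 ?enorm_ge0// exprMn !sqr_enorm.
rewrite real_normK ?num_real// -subr_ge0.
have -> : dot x x * dot y y - dot x y ^+ 2 = (x 0 0 * y 0 1 - x 0 1 * y 0 0) ^+ 2.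
  by rewrite !dotE; ring.
exact: sqr_ge0.
Qed.

Lemma enormD {R : realType} (x y : 'rV[R]_2) : enorm (x + y) <= enorm x + enorm y.
Proof.
rewrite -(ler_pXn2r (n:=2)) ?nnegrE ?addr_ge0 ?enorm_ge0//.
rewrite sqrrD !sqr_enorm dotDl [dot x _]dotC [dot y _]dotC !dotDl [dot y x]dotC.
by have := dot_le_enorm x y; lra.
Qed.

Lemma dot_unit_le {R : realType} (x u : 'rV[R]_2) : enorm u = 1 -> dot x u <= enorm x.
Proof. by move=> u1; have := dot_le_enorm x u; rewrite u1 mulr1. Qed.

Lemma dot_unit_self {R : realType} (u : 'rV[R]_2) : enorm u = 1 -> dot u u = 1.
Proof. by move=> u1; rewrite -sqr_enorm u1 expr1n. Qed.

Lemma unit_neq0 {R : realType} (u : 'rV[R]_2) : enorm u = 1 -> u != 0.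
Proof.
move=> u1; apply/eqP => u0; move: u1.
rewrite u0 -(scale0r (0 : 'rV[R]_2)) enormZ normr0 mul0r.
by move/eqP; rewrite eq_sym oner_eq0.
Qed.

Lemma closed_disk_dot {R : realType} (c : 'rV[R]_2) (rho : R) x u : enorm u = 1 ->
  closed_disk c rho x -> dot c u - rho <= dot x u <= dot c u + rho.
Proof.
move=> u1; rewrite /closed_disk/= => xc.
have := dot_unit_le (x - c) u u1; have := dot_unit_le (- (x - c)) u u1.
by rewrite enormN !dotNl dotDl dotNl; lra.
Qed.

(** Barycentric combinations of rows, without the structure of convex space on the
    type of rows. *)
Lemma convex_set_row {R : realType} (A : set 'rV[R]_2) :
  (forall (x y : 'rV[R]_2) (k : R), 0 < k < 1 -> A x -> A y ->
    A (k *: x + (1 - k) *: y)) -> convex_set A.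
Proof.
move=> h; apply/convex_setW => x y /set_mem xA /set_mem yA k k0 k1.
by apply/mem_set; apply: (h x y k%:num) => //; rewrite k0 k1.
Qed.

Lemma convex_closed_disk {R : realType} (c : 'rV[R]_2) (rho : R) :
  convex_set (closed_disk c rho).
Proof.
apply: convex_set_row => x y k /andP[k0 k1]; rewrite /closed_disk/= => xc yc.
have -> : k *: x + (1 - k) *: y - c = k *: (x - c) + (1 - k) *: (y - c).
  by apply/rowP => i; rewrite !mxE; ring.
apply: le_trans (enormD _ _) _; rewrite !enormZ !ger0_norm ?subr_ge0 ?(ltW k0) ?(ltW k1)//.
by nra.
Qed.

Lemma convex_halfplane {R : realType} (u : 'rV[R]_2) (t : R) :
  convex_set [set x | t < dot x u]%classic.
Proof.
by apply: convex_set_row => x y k /andP[k0 k1] /= xc yc; rewrite dotDl !dotZl; nra.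
Qed.

Lemma dot_continuous {R : realType} (u : 'rV[R]_2) :
  continuous (fun x : 'rV[R]_2 => dot x u).
Proof.
pose f i (x : 'rV[R]_2) : R := x 0 i * u 0 i.
have fc i : continuous (f i).
  move=> x; apply: (@continuousM R 'rV[R]_2 (fun x => x 0 i) (fun=> u 0 i) x).
    exact: coord_continuous.
  exact: cst_continuous.
have -> : (fun x : 'rV[R]_2 => dot x u) = f 0 + f 1.
  by apply/funext => x; rewrite dotE.
by move=> x; apply: continuousD; exact: fc.
Qed.

Lemma enorm_continuous {R : realType} (c : 'rV[R]_2) :
  continuous (fun x : 'rV[R]_2 => enorm (x - c)).
Proof.
move=> x; apply: (@continuous_comp _ _ _ (fun x : 'rV[R]_2 => dot (x - c) (x - c)) Num.sqrt);
  last exact: sqrt_continuous.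
pose f i (x : 'rV[R]_2) : R := x 0 i - c 0 i.
have fc i : continuous (f i).
  move=> y; apply: (@continuousB R R 'rV[R]_2 (fun x => x 0 i) (fun=> c 0 i) y).
    exact: coord_continuous.
  exact: cst_continuous.
have -> : (fun x : 'rV[R]_2 => dot (x - c) (x - c)) = f 0 * f 0 + f 1 * f 1.
  by apply/funext => y; rewrite dotE !mxE.
by apply: continuousD; apply: continuousM; exact: fc.
Qed.

Lemma plank_setE {R : realType} (P : plank R) (x : 'rV[R]_2) :
  plank_lo P <= dot x (plank_normal P) <= plank_hi P -> plank_set P x.
Proof.
move=> h; exists (dot x (plank_normal P) *: plank_normal P).
  by exists (dot x (plank_normal P)); rewrite //= in_itv.
exists (x - dot x (plank_normal P) *: plank_normal P); last by rewrite addrC subrK.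
rewrite /plank_line/= dotDl dotNl dotZl dot_unit_self ?mulr1 ?subrr//.
exact: plank_normal_unit.
Qed.

(** An open strip and an open disk meet in a neighbourhood of each of their
    common points. *)
Lemma mem_interior_plank {R : realType} (P : plank R) (D : disk R) (K : set 'rV[R]_2) x :
  (disk_set D `<=` K)%classic ->
  plank_lo P < dot x (plank_normal P) < plank_hi P ->
  enorm (x - disk_center D) < disk_radius D ->
  interior (plank_set P `&` K)%classic x.
Proof.
move=> DK /andP[lx xh] xD; rewrite /interior/=.
have dc := @dot_continuous R (plank_normal P) x.
have hl : \forall y \near x, plank_lo P < dot y (plank_normal P).
  exact: cvgr_gt dc _ lx.
have hh : \forall y \near x, dot y (plank_normal P) < plank_hi P.
  exact: cvgr_lt dc _ xh.
have hD : \forall y \near x, enorm (y - disk_center D) < disk_radius D.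
  exact: cvgr_lt (@enorm_continuous R (disk_center D) x) _ xD.
near=> y; split.
  by apply: plank_setE; rewrite !ltW//; near: y.
by apply: DK; rewrite /disk_set /closed_disk/= ltW//; near: y.
Unshelve. all: by end_near. Qed.

Lemma unit_polar {R : realType} (u : 'rV[R]_2) : enorm u = 1 ->
  exists phi : R, [/\ - pi <= phi <= pi, u 0 0 = cos phi & u 0 1 = sin phi].
Proof.
move=> u1; have u2 : u 0 0 ^+ 2 + u 0 1 ^+ 2 = 1.
  by rewrite !expr2 -dotE dot_unit_self.
have pi0 := pi_gt0 R.
have uB : -1 <= u 0 0 <= 1 by apply/andP; split; nra.
have s : Num.sqrt (1 - u 0 0 ^+ 2) = `|u 0 1|.
  by rewrite -u2 addrC addKr sqrtr_sqr.
have := acos_ge0 uB; have := acos_lepi uB => ap a0.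
have [h|h] := leP 0 (u 0 1).
  exists (acos (u 0 0)); split; first lra.
    by rewrite acosK// in_itv.
  by rewrite sin_acos// s ger0_norm.
exists (- acos (u 0 0)); split; first lra.
  by rewrite cosN acosK// in_itv.
by rewrite sinN sin_acos// s ltr0_norm// opprK.
Qed.

(** * Planks in a non-separable domain *)

(** For a unit vector u, the shadow is the projection of the disk to the line
    spanned by u. *)
Definition shadow_lo {R : realType} (D : disk R) (u : 'rV[R]_2) : R :=
  dot (disk_center D) u - disk_radius D.
Definition shadow_hi {R : realType} (D : disk R) (u : 'rV[R]_2) : R :=
  dot (disk_center D) u + disk_radius D.

(** Rescale the disk to the unit disk and truncate every plank to the shadow of
    the disk in its direction. *)
Lemma disk_plank_packing {R : realType} (r N : nat) (D : disk R) (K : set 'rV[R]_2)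
    (C : 'I_N -> plank R) : (disk_set D `<=` K)%classic ->
  (forall x, K x ->
    (#|[set i : 'I_N | `[< interior (plank_set (C i) `&` K)%classic x >] ]%SET| <= r)%N) ->
  \sum_j overlap (plank_lo (C j)) (plank_hi (C j))
    (shadow_lo D (plank_normal (C j))) (shadow_hi D (plank_normal (C j)))
  <= r%:R * (2 * disk_radius D).
Proof.
move=> DK cnt.
have [phi phiP] := boolp.choice (fun j => unit_polar _ (plank_normal_unit (C j))).
have rho0 := disk_radius_gt0 D.
set c := disk_center D; set rho := disk_radius D in rho0 *.
pose t j := dot c (plank_normal (C j)).
pose A j := Num.max (plank_lo (C j)) (t j - rho).
pose B j := Num.min (plank_hi (C j)) (t j + rho).
pose a j := if A j < B j then (A j - t j) / rho else 0.
pose b j := if A j < B j then (B j - t j) / rho else 0.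
have E j : overlap (plank_lo (C j)) (plank_hi (C j)) (shadow_lo D (plank_normal (C j)))
    (shadow_hi D (plank_normal (C j))) = rho * (b j - a j).
  rewrite /overlap /shadow_lo /shadow_hi -/c -/rho -/(t j) -/(A j) -/(B j) /a /b.
  case: (ltP (A j) (B j)) => AB.
    by rewrite [LHS]max_r ?subr_ge0 ?(ltW AB)//; field; rewrite gt_eqF.
  by rewrite [LHS]max_l ?subr_le0// subrr mulr0.
rewrite (eq_bigr _ (fun j _ => E j)) -mulr_sumr.
rewrite (_ : r%:R * (2 * rho) = rho * (2 * r%:R)); last by ring.
rewrite ler_pM2l//.
have AB1 j : A j < B j -> t j - rho <= A j /\ B j <= t j + rho.
  by move=> _; rewrite le_max lexx orbT ge_min lexx orbT.
apply: (@unit_disk_packing R N r a b phi).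
- move=> j; rewrite /a; case: ifPn => [AB|_]; last lra.
  by have := AB1 j AB; rewrite ler_pdivlMr// ler_pdivrMr//; lra.
- move=> j; rewrite /b; case: ifPn => [AB|_]; last lra.
  by have := AB1 j AB; rewrite ler_pdivlMr// ler_pdivrMr//; lra.
- by move=> j; case: (phiP j).
move=> w th /andP[w0 w1].
pose v : 'rV[R]_2 := \row_(i < 2) (if i == 0 then cos th else sin th).
pose x := c + (rho * w) *: v.
have v1 : enorm v = 1.
  by rewrite /enorm dotE !mxE/= -!expr2 cos2Dsin2 sqrtr1.
have xc : enorm (x - c) = rho * w.
  by rewrite /x addrC addKr enormZ v1 mulr1 ger0_norm// mulr_ge0 ?ltW.
have xlt : enorm (x - c) < rho by rewrite xc gtr_pMr.
have Kx : K x by apply: DK; rewrite /disk_set /closed_disk/= ltW.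
apply: leq_trans (cnt x Kx); apply: subset_leq_card; apply/fintype.subsetP => j.
rewrite !inE => /andP[aw wb]; apply/asboolP; apply/asboolP.
apply: (@mem_interior_plank R (C j) D K x) => //.
have [_ u0 u1] := phiP j.
have -> : dot x (plank_normal (C j)) = t j + rho * (w * cos (th - phi j)).
  rewrite dotDl dotZl -/(t j) (dotE v) !mxE/= u0 u1 cosB; ring.
move: aw wb; rewrite /a /b; case: ifPn => [AB|_]; last first.
  by move=> h1 h2; have := lt_trans h1 h2; rewrite ltxx.
rewrite ltr_pdivrMr// ltr_pdivlMr// => h1 h2.
have lA : plank_lo (C j) <= A j by rewrite le_max lexx.
have lB : B j <= plank_hi (C j) by rewrite ge_min lexx.
lra.
Qed.

(** Otherwise the line orthogonal to u at s separates the disks. *)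
Lemma NS_shadow_connected {R : realType} (n : nat) (D : 'I_n -> disk R)
    (u : 'rV[R]_2) (s : R) :
  NS_family D -> enorm u = 1 ->
  (exists i, shadow_lo (D i) u <= s) -> (exists i, s <= shadow_hi (D i) u) ->
  exists i, shadow_lo (D i) u <= s <= shadow_hi (D i) u.
Proof.
move=> [_ NS] u1 [i il] [k kh]; apply: contrapT => no; apply: NS; exists u, s.
split; first exact: unit_neq0.
have out j : s < shadow_lo (D j) u \/ shadow_hi (D j) u < s.
  have [h|h] := ltP s (shadow_lo (D j) u); first by left.
  have [h'|h'] := ltP (shadow_hi (D j) u) s; first by right.
  by case: no; exists j; rewrite h h'.
split.
- move=> j; rewrite -subset0 => x [/(closed_disk_dot _ _ _ _ u1) xj /= xs].
  by have := out j; rewrite /shadow_lo /shadow_hi; lra.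
- exists i => x /(closed_disk_dot _ _ _ _ u1) xj /=.
  by have := out i; move: il; rewrite /shadow_lo /shadow_hi; lra.
- exists k => x /(closed_disk_dot _ _ _ _ u1) xj /=.
  by have := out k; move: kh; rewrite /shadow_lo /shadow_hi; lra.
Qed.

(** If every shadow started after the projection of x, the domain would lie in an
    open half-plane that excludes x. *)
Lemma NS_domain_shadow {R : realType} (n : nat) (D : 'I_n -> disk R) (u x : 'rV[R]_2) :
  NS_family D -> enorm u = 1 -> NS_domain D x -> exists i, shadow_lo (D i) u <= dot x u.
Proof.
move=> NS u1 Kx; apply: contrapT => no.
suff : (NS_domain D `<=` [set y | dot x u < dot y u])%classic.
  by move=> /(_ _ Kx); rewrite /= ltxx.
apply: smallest_sub; first exact: convex_halfplane.
move=> y [i _ /(closed_disk_dot _ _ _ _ u1) yi] /=.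
have [h|h] := leP (shadow_lo (D i) u) (dot x u); first by case: no; exists i.
by move: h; rewrite /shadow_lo; lra.
Qed.

Lemma dotNr {R : realType} (x u : 'rV[R]_2) : dot x (- u) = - dot x u.
Proof. by rewrite dotC dotNl dotC. Qed.

(** The shadows of the disks cover the base of the plank. *)
Lemma plank_width_le {R : realType} (n : nat) (D : 'I_n -> disk R) (P : plank R) :
  NS_family D -> (plank_base P `<=` plank_proj P @` NS_domain D)%classic ->
  plank_width P <= \sum_i overlap (plank_lo P) (plank_hi P)
    (shadow_lo (D i) (plank_normal P)) (shadow_hi (D i) (plank_normal P)).
Proof.
move=> NS sub; have u1 := plank_normal_unit P; set u := plank_normal P in u1 *.
apply: length_le_sum_overlap => s /andP[ls sh].
have [|x Kx xs] := sub (s *: u).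
  by exists s => //; rewrite /= in_itv/= !ltW.
have {}xs : dot x u = s.
  have := congr1 (fun y => dot y u) xs.
  by rewrite /plank_proj !dotZl -/u dot_unit_self// !mulr1.
have [||i iP] := @NS_shadow_connected R n D u s NS u1; last by exists i.
  by rewrite -xs; exact: NS_domain_shadow.
have [|i] := @NS_domain_shadow R n D (- u) x NS _ Kx; first by rewrite enormN.
rewrite /shadow_lo !dotNr xs => h; exists i; rewrite /shadow_hi; lra.
Qed.

Lemma sub_NS_domain {R : realType} (n : nat) (D : 'I_n -> disk R) i :
  (disk_set (D i) `<=` NS_domain D)%classic.
Proof. by move=> x xi; apply: sub_gen_smallest; exists i. Qed.

Lemma NS_domain_packing {R : realType} (n : nat) (D : 'I_n -> disk R) (r N : nat)
    (C : 'I_N -> plank R) : NS_family D -> fold_packing r (NS_domain D) C ->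
  \sum_(i < N) plank_width (C i) <= r%:R * NS_diameter D.
Proof.
move=> NS [sub cnt].
apply: le_trans (ler_sum _ (fun j _ => plank_width_le _ D (C j) NS (sub j))) _.
rewrite exchange_big/= /NS_diameter mulr_sumr; apply: ler_sum => i _.
by apply: disk_plank_packing cnt; exact: sub_NS_domain.
Qed.

(** * Chains of intervals *)

Lemma overlap_le_length {R : realType} (a b lo hi : R) : lo <= hi ->
  overlap a b lo hi <= hi - lo.
Proof.
move=> lh; rewrite ge_max subr_ge0 lh lerB//; first by rewrite ge_min lexx orbT.
by rewrite le_max lexx orbT.
Qed.

Section ChainOfIntervals.
Context {R : realType} {n : nat} (t rho : 'I_n -> R).
Context (rho_gt0 : forall i, 0 < rho i).
Context (connected : forall s, (exists i, t i - rho i <= s) ->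
  (exists i, s <= t i + rho i) -> exists i, t i - rho i <= s <= t i + rho i).

Let hi i := t i + rho i.
Let P := \sum_i rho i.
Let later j := \sum_(l | hi j < hi l) 2 * rho l.

(** A point between hi j and hi m lies in some interval by connectedness, and that
    interval ends after hi j. *)
Lemma gap_le_later (m j : 'I_n) : hi m - hi j <= later j.
Proof.
apply: le_trans (_ : \sum_(l | hi j < hi l) overlap (hi j) (hi m) (t l - rho l) (hi l) <= _).
  apply: length_le_sum_overlap => s /andP[js sm].
  have [||i /andP[il ih]] := connected s.
  - by exists j; have := rho_gt0 j; move: js; rewrite /hi; lra.
  - by exists m; exact: ltW.
  by exists i; [exact: lt_le_trans ih|rewrite il].
apply: ler_sum => l _; apply: le_trans (overlap_le_length _ _ _ _ _) _;
  have := rho_gt0 l; rewrite /hi; lra.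
Qed.

(** The defect in [chain_right_end] as a sum of nonnegative terms: the slack in the
    gap estimates, and the pairs of intervals with a common right end.  The latter
    appear because P^2 counts all ordered pairs of intervals, the weighted gap
    estimates only those whose right ends differ. *)
Lemma chain_defect (M : R) :
  P ^+ 2 + \sum_i rho i * t i - M * P =
  \sum_j rho j * (later j - (M - hi j)) +
  \sum_j \sum_l ((j != l) && (hi j == hi l))%:R * (rho j * rho l).
Proof.
have PE : P ^+ 2 = \sum_j \sum_l rho j * rho l.
  by rewrite expr2 /P mulr_suml; apply: eq_bigr => j _; rewrite mulr_sumr.
have X : \sum_j rho j * later j =
    \sum_j \sum_l ((hi j < hi l)%R%:R + (hi l < hi j)%R%:R) * (rho j * rho l).
  transitivity (\sum_j \sum_l (hi j < hi l)%R%:R * (rho j * rho l)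
              + \sum_j \sum_l (hi l < hi j)%R%:R * (rho j * rho l)).
    rewrite [in X in _ + X]exchange_big/= -big_split/=; apply: eq_bigr => j _.
    rewrite /later mulr_sumr big_mkcond -big_split/=; apply: eq_bigr => l _.
    by case: ifP => _ /=; ring.
  rewrite -big_split/=; apply: eq_bigr => j _; rewrite -big_split/=.
  by apply: eq_bigr => l _; rewrite mulrDl.
have S2 : \sum_j rho j ^+ 2 = \sum_j \sum_l (j == l)%:R * (rho j * rho l).
  apply: eq_bigr => j _; rewrite (bigD1 j)//= eqxx mul1r big1 ?addr0// => l lj.
  by rewrite eq_sym (negbTE lj) mul0r.
have E : \sum_j \sum_l ((j != l) && (hi j == hi l))%:R * (rho j * rho l) =
    P ^+ 2 - \sum_j rho j ^+ 2 - \sum_j rho j * later j.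
  rewrite PE S2 X -!sumrB; apply: eq_bigr => j _; rewrite -!sumrB.
  apply: eq_bigr => l _; have [->|jl] := eqVneq j l.
    by rewrite ltxx/=; ring.
  by case: ltgtP => _ /=; ring.
rewrite E; have -> : \sum_j rho j * (later j - (M - hi j)) =
    \sum_j rho j * later j - M * P + \sum_i rho i * t i + \sum_j rho j ^+ 2.
  rewrite /P mulr_sumr -sumrB -!big_split/=; apply: eq_bigr => j _.
  by rewrite /hi; ring.
ring.
Qed.

Lemma later_term_ge0 m j : 0 <= rho j * (later j - (hi m - hi j)).
Proof. by rewrite mulr_ge0 ?(ltW (rho_gt0 j))// subr_ge0 gap_le_later. Qed.

Lemma tie_term_ge0 j l : 0 <= ((j != l) && (hi j == hi l))%:R * (rho j * rho l).
Proof. by rewrite !mulr_ge0 ?ler0n ?(ltW (rho_gt0 _)). Qed.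

Lemma chain_right_end (m : 'I_n) : hi m * P <= \sum_i rho i * t i + P ^+ 2.
Proof.
rewrite -subr_ge0 [X in X - _]addrC chain_defect addr_ge0// sumr_ge0// => j _.
  exact: later_term_ge0.
by apply: sumr_ge0 => l _; exact: tie_term_ge0.
Qed.

(** Both kinds of terms of the defect vanish, so the right ends are distinct and the
    gap estimates are equalities.  For the leftmost right end hi j the later
    intervals are all the others, which locates t j - rho j. *)
Lemma chain_right_end_eq (m : 'I_n) : hi m * P = \sum_i rho i * t i + P ^+ 2 ->
  exists j, t j - rho j = hi m - 2 * P.
Proof.
move=> /eqP; rewrite eq_sym -subr_eq0 [X in X - _]addrC chain_defect.
rewrite paddr_eq0; last 2 first.
- by apply: sumr_ge0 => j _; exact: later_term_ge0.
- by apply: sumr_ge0 => j _; apply: sumr_ge0 => l _; exact: tie_term_ge0.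
rewrite !psumr_eq0; last 2 first.
- by move=> j _; apply: sumr_ge0 => l _; exact: tie_term_ge0.
- by move=> j _; exact: later_term_ge0.
move=> /andP[/allP gap /allP tie].
have [j _ jmin] : exists2 j, true & forall l, hi j <= hi l.
  by case: (arg_minP hi (isT : xpredT m)) => j _ jP; exists j => // l; exact: jP.
exists j.
have /eqP gj := gap j (mem_index_enum _).
have {gj}gj : later j = hi m - hi j.
  move/eqP: gj; rewrite mulf_eq0 gt_eqF ?rho_gt0//= subr_eq0 => /eqP ->//.
have jlt l : l != j -> hi j < hi l.
  move=> lj; rewrite lt_neqAle jmin andbT; apply/negP => /eqP jl.
  have := tie j (mem_index_enum _).
  rewrite psumr_eq0; last by move=> k _; exact: tie_term_ge0.
  move=> /allP/(_ l (mem_index_enum _)) /=.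
  by rewrite [j == l]eq_sym lj jl eqxx mul1r mulf_eq0 !gt_eqF ?rho_gt0.
have : later j = 2 * (P - rho j).
  rewrite /P (bigD1 j)//= addrAC subrr add0r mulr_sumr /later; apply: eq_bigl => l.
  by have [->|lj] := eqVneq l j; rewrite ?ltxx//= jlt.
rewrite gj /hi; lra.
Qed.

End ChainOfIntervals.

(** * The covering disk of Goodman and Goodman *)

Definition radius_sum {R : realType} {n : nat} (D : 'I_n -> disk R) : R :=
  \sum_i disk_radius (D i).

Definition weighted_center {R : realType} {n : nat} (D : 'I_n -> disk R) : 'rV[R]_2 :=
  (radius_sum D)^-1 *: \sum_i disk_radius (D i) *: disk_center (D i).

Lemma NS_diameterE {R : realType} {n : nat} (D : 'I_n -> disk R) :
  NS_diameter D = 2 * radius_sum D.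
Proof. by rewrite /NS_diameter mulr_sumr. Qed.

Lemma radius_sum_gt0 {R : realType} {n : nat} (D : 'I_n -> disk R) : (0 < n)%N ->
  0 < radius_sum D.
Proof.
case: n D => // n D _; rewrite /radius_sum big_ord_recl ltr_pwDl ?disk_radius_gt0//.
by rewrite sumr_ge0// => i _; rewrite ltW// disk_radius_gt0.
Qed.

Lemma dot_weighted_center {R : realType} {n : nat} (D : 'I_n -> disk R) u : (0 < n)%N ->
  radius_sum D * dot (weighted_center D) u =
  \sum_i disk_radius (D i) * dot (disk_center (D i)) u.
Proof.
move=> n0; rewrite dotZl mulrA divff ?mul1r ?gt_eqF ?radius_sum_gt0//.
elim/big_rec2: _ => [|i y x _ <-]; first by rewrite dotE !mxE; ring.
by rewrite dotDl dotZl.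
Qed.

Lemma shadow_hi_le {R : realType} {n : nat} (D : 'I_n -> disk R) u i :
  NS_family D -> enorm u = 1 ->
  shadow_hi (D i) u <= dot (weighted_center D) u + radius_sum D.
Proof.
move=> NS u1; have n0 := NS.1.
rewrite -(ler_pM2r (radius_sum_gt0 D n0)) [leRHS]mulrDl.
rewrite [dot (weighted_center D) u * _]mulrC dot_weighted_center//.
apply: (@chain_right_end R n (fun i => dot (disk_center (D i)) u)
  (fun i => disk_radius (D i))) => [j|s]; first exact: disk_radius_gt0.
exact: NS_shadow_connected.
Qed.

(** For x = 0 any unit vector does; this spares a separate treatment of a disk
    centered at the barycenter. *)
Lemma exists_direction {R : realType} (x : 'rV[R]_2) :
  exists2 u : 'rV[R]_2, enorm u = 1 & dot x u = enorm x.
Proof.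
have [x0|x0] := eqVneq (enorm x) 0.
  exists (\row_(i < 2) (if i == 0 then 1 else 0)).
    by rewrite /enorm dotE !mxE/= mulr1 mulr0 addr0 sqrtr1.
  move: (sqr_enorm x); rewrite x0 expr0n/= dotE -!expr2 => /eqP.
  rewrite eq_sym paddr_eq0 ?sqr_ge0// !sqrf_eq0 => /andP[/eqP h0 /eqP h1].
  by rewrite dotE h0 h1 !mul0r addr0.
exists ((enorm x)^-1 *: x).
  by rewrite enormZ ger0_norm ?invr_ge0 ?enorm_ge0// mulVf.
by rewrite dotC dotZl -sqr_enorm expr2 mulrA mulVf// mul1r.
Qed.

(** The shadow inequality in the direction from the barycenter to the center of the
    disk. *)
Lemma disk_reach_le_radius_sum {R : realType} {n : nat} (D : 'I_n -> disk R) i :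
  NS_family D ->
  enorm (disk_center (D i) - weighted_center D) + disk_radius (D i) <= radius_sum D.
Proof.
move=> NS; have [u u1 <-] := exists_direction (disk_center (D i) - weighted_center D).
by have := shadow_hi_le D u i NS u1; rewrite /shadow_hi dotDl dotNl; lra.
Qed.

Lemma NS_domain_sub_closed_disk {R : realType} {n : nat} (D : 'I_n -> disk R) c rho :
  (forall i, enorm (disk_center (D i) - c) + disk_radius (D i) <= rho) ->
  (NS_domain D `<=` closed_disk c rho)%classic.
Proof.
move=> h; apply: smallest_sub; first exact: convex_closed_disk.
move=> x [i _]; rewrite /disk_set /closed_disk/= => xi; apply: le_trans (h i).
rewrite -(subrK (disk_center (D i)) x) -addrA addrC.
by apply: le_trans (enormD _ _) _; rewrite lerD2l.
Qed.

Lemma NS_domain_disk_point {R : realType} {n : nat} (D : 'I_n -> disk R) i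
    (u : 'rV[R]_2) (a : R) :
  enorm u = 1 -> `|a| <= disk_radius (D i) ->
  NS_domain D (disk_center (D i) + a *: u).
Proof.
move=> u1 ai; apply: (sub_NS_domain _ D i).
by rewrite /disk_set /closed_disk/= addrC addKr enormZ u1 mulr1.
Qed.

Lemma circumradius_le {R : realType} {n : nat} (D : 'I_n -> disk R) c rho : (0 < n)%N ->
  (NS_domain D `<=` closed_disk c rho)%classic -> circumradius (NS_domain D) <= rho.
Proof.
case: n D => // n D _ sub; apply: ge_inf; last by exists c.
exists 0 => r [d dr].
have : NS_domain D (disk_center (D ord0)).
  apply: (sub_NS_domain _ D ord0).
  rewrite /disk_set /closed_disk/= subrr -(scale0r (0 : 'rV[R]_2)) enormZ normr0 mul0r.
  exact/ltW/disk_radius_gt0.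
by move/dr; rewrite /closed_disk/=; apply: le_trans; exact: enorm_ge0.
Qed.

(** Otherwise the covering disk could be shrunk to the largest reach. *)
Lemma exists_touching_disk {R : realType} {n : nat} (D : 'I_n -> disk R) : NS_family D ->
  circumradius (NS_domain D) = radius_sum D ->
  exists i, enorm (disk_center (D i) - weighted_center D) + disk_radius (D i) = radius_sum D.
Proof.
move=> NS cR; have n0 := NS.1.
pose reach i := enorm (disk_center (D i) - weighted_center D) + disk_radius (D i).
have [m mmax] : exists m, forall i, reach i <= reach m.
  case: (arg_maxP reach (isT : xpredT (Ordinal n0))) => m _ mP.
  by exists m => i; exact: mP.
exists m; apply/eqP; rewrite eq_le disk_reach_le_radius_sum//= -cR.
by apply: (circumradius_le D (weighted_center D) _ n0); exact: NS_domain_sub_closed_disk mmax.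
Qed.

(** In the direction of contact the extreme points of two of the disks are at
    distance 2 P along u. *)
Lemma diameter_of_tight_circumradius {R : realType} {n : nat} (D : 'I_n -> disk R) :
  NS_family D ->
  circumradius (NS_domain D) = radius_sum D ->
  diameter (NS_domain D) = 2 * radius_sum D.
Proof.
move=> NS cR; have n0 := NS.1; have P0 := radius_sum_gt0 D n0.
set c := weighted_center D.
have ub : ubound [set enorm (x - y) | x in NS_domain D & y in NS_domain D]%classic
    (2 * radius_sum D).
  move=> _ [x Kx [y Ky <-]].
  have sub := @NS_domain_sub_closed_disk R n D c _ (fun i => disk_reach_le_radius_sum D i NS).
  have xc := sub _ Kx; have yc := sub _ Ky; rewrite /closed_disk/= in xc yc.
  have -> : x - y = (x - c) + - (y - c) by rewrite opprB addrA subrK.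
  by apply: le_trans (enormD _ _) _; rewrite enormN; lra.
have [i touch] := exists_touching_disk D NS cR.
have [u u1 uc] := exists_direction (disk_center (D i) - c).
have [j jP] : exists j, dot (disk_center (D j)) u - disk_radius (D j) =
    dot (disk_center (D i)) u + disk_radius (D i) - 2 * radius_sum D.
  apply: (@chain_right_end_eq R n (fun i => dot (disk_center (D i)) u)
    (fun i => disk_radius (D i))) => [k|s|].
  - exact: disk_radius_gt0.
  - exact: NS_shadow_connected.
  - rewrite -dot_weighted_center// -/(radius_sum D) -touch -uc dotDl dotNl -/c; ring.
set x := disk_center (D i) + disk_radius (D i) *: u.
set y := disk_center (D j) + (- disk_radius (D j)) *: u.
have Kx : NS_domain D x.
  by apply: NS_domain_disk_point; rewrite // ger0_norm// ltW// disk_radius_gt0.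
have Ky : NS_domain D y.
  by apply: NS_domain_disk_point; rewrite // normrN ger0_norm// ltW// disk_radius_gt0.
apply/eqP; rewrite eq_le; apply/andP; split.
  by apply: ge_sup => //; exists (enorm (x - y)); exists x => //; exists y.
apply: (@le_trans _ _ (enorm (x - y))).
  apply: le_trans (dot_unit_le (x - y) u u1).
  by rewrite !dotDl dotNl !dotDl !dotZl dot_unit_self//; lra.
by apply: ub_le_sup; [exists (2 * radius_sum D)|exists x => //; exists y].
Qed.

Theorem theorem6p1 (R : realType) (n : nat) (D : 'I_n -> disk R)
    (hD : NS_family D) :
  (forall (r N : nat) (C : 'I_N -> plank R),
      (1 <= r)%N -> fold_packing r (NS_domain D) C ->
      \sum_(i < N) plank_width (C i) <= r%:R * NS_diameter D)
  /\ 2 * circumradius (NS_domain D) <= NS_diameter D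
  /\ (2 * circumradius (NS_domain D) = NS_diameter D <->
      2 * circumradius (NS_domain D) = NS_diameter D /\
      NS_diameter D = diameter (NS_domain D)).
Proof.
split; first by move=> r N C _; exact: NS_domain_packing.
rewrite NS_diameterE; split.
  rewrite ler_pM2l//; apply: (circumradius_le D _ _ hD.1).
  by apply: NS_domain_sub_closed_disk => i; exact: disk_reach_le_radius_sum.
split=> [h|[]//]; split=> //; rewrite diameter_of_tight_circumradius//.
by apply: (@mulfI _ 2); rewrite ?pnatr_eq0.
Qed.
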